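(* Let $h$ and $k$ be positive integers such that $3 \leq h \leq k-1$ and $k \geq 5$. Let $A$ be a set of $k$ integers such that $A \cap (-A) = \{0\}$. Then \[ |h^{\wedge}_{\pm}A| \geq 2hk - h(h+1) + 1. \] Moreover, this lower bound is best possible: for all such $h$ and $k$ there is such a set $A$ for which equality holds.
   Context: For a finite set $A=\{a_1,\ldots,a_k\}$ of integers and a positive integer $h$, the restricted $h$-fold signed sumset is $h^{\wedge}_{\pm}A=\left\{\sum_{i=1}^{k}\lambda_i a_i : \lambda_i\in\{-1,0,1\} \text{ for all } i,\ \sum_{i=1}^{k}|\lambda_i| = h\right\}$. $-A=\{-a: a\in A\}$. *)

(* Defs.v *)
From mathcomp Require Import all_boot all_order all_algebra.
From mathcomp Require Import finmap.
Set Implicit Arguments.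
Unset Strict Implicit.
Unset Printing Implicit Defensive.
Import GRing.Theory Num.Theory.
Local Open Scope fset_scope.
Local Open Scope ring_scope.

Definition oppset (A : {fset int}) : {fset int} := [fset - a | a in A].

Definition signs : {fset int} := [fset -1; 0; 1].

Definition signed_sum (A : {fset int}) (lam : {ffun A -> signs}) : int :=
  \sum_(a : A) fsval (lam a) * fsval a.

Definition weight (A : {fset int}) (lam : {ffun A -> signs}) : int :=
  \sum_(a : A) `|fsval (lam a)|.

Definition restricted_signed_sumset (h : nat) (A : {fset int}) : {fset int} :=
  [fset signed_sum lam | lam : {ffun A -> signs} & weight lam == h%:Z].

(* Main.v *)
(* Flipping signs of the elements of [A] does not change the signed sumset, so
   let [A = {0} U B] with [B] a set of [m = k - 1] positive integers; the sums
   are those using exactly [h] or [h - 1] elements of [B].  Removing the largest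
   element of [B] loses at least [2 h] sums as long as [h <= m - 1], which leaves
   [h = m], where [m^2 + m + 1] sums are needed, and one small case.

   For [h = m], let [b] be the largest element and [s] the other ones.  The sums
   for [b :: s] contain [X - b] and [X + b], where [X] is the set of sums for [s],
   and [|(X - b) U (X + b)|] exceeds [|X|] by at least the number of residues of
   [X] modulo [2 b].  If [s] contains an odd [o], and [M] is the sum of [s], the
   residues of [M - 2 x] and [M - o - 2 x] give [2 m - 1] classes of two distinct
   parities, and one more is found unless [s] is made of multiples of [b - max s],
   where it is explicit.  If only [b] is odd, the sums of weight [m - 1] avoiding
   [b] differ in parity from all the [X +- b].  If everything is even, divide by 2.
   The bound for three elements fails exactly for [{a, 2 a, 4 a}].

   The bound is attained by [{0, ..., k - 1}], whose sums have absolute value at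
   most that of the sum of the [h] largest elements. *)
Require Import Defs.
From mathcomp Require Import all_boot all_order all_algebra.
From mathcomp Require Import finmap zify ring.
Local Open Scope fset_scope.
Local Open Scope ring_scope.
Set Implicit Arguments.
Unset Strict Implicit.
Import Order.TTheory GRing.Theory Num.Theory.

(** * Signed sums of a list *)

(** Recursion on the list makes adjoining or discarding one element a single rewrite; [ssumP] links
    it to coefficients in [signs]. *)
Fixpoint ssum (h : nat) (s : seq int) : {fset int} :=
  match s, h with
  | [::], 0%N => [fset 0]
  | [::], _.+1 => fset0
  | a :: s', 0%N => ssum 0 s'
  | a :: s', h'.+1 =>
      ssum h s' `|` ([fset x + a | x in ssum h' s'] `|` [fset x - a | x in ssum h' s'])
  end.

Lemma ssum_nil h x : (x \in ssum h [::]) = (h == 0%N) && (x == 0).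
Proof. by case: h => [|h]; rewrite /= !inE. Qed.

Lemma ssum0_cons a s : ssum 0 (a :: s) = ssum 0 s.
Proof. by []. Qed.

Lemma ssumS_cons h a s x :
  (x \in ssum h.+1 (a :: s)) =
    [|| x \in ssum h.+1 s, x - a \in ssum h s | x + a \in ssum h s].
Proof.
rewrite /= !inE; congr (_ || (_ || _)); apply/imfsetP/idP => /= [[y yin ->]|H].
- by rewrite addrK.
- by exists (x - a) => //; rewrite subrK.
- by rewrite subrK.
- by exists (x + a) => //; rewrite addrK.
Qed.

Arguments ssum : simpl never.

Lemma ssum0 s x : (x \in ssum 0 s) = (x == 0).
Proof. by elim: s => [|a s IH]; rewrite ?ssum_nil // ssum0_cons. Qed.

Lemma ssum_oppr h s x : (- x \in ssum h s) = (x \in ssum h s).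
Proof.
elim: s h x => [|a s IH] [|h] x; rewrite ?ssum_nil ?ssum0 ?oppr_eq0 //.
rewrite !ssumS_cons IH -(IH h (- x - a)) -(IH h (- x + a)).
rewrite (_ : - (- x - a) = x + a); last by ring.
rewrite (_ : - (- x + a) = x - a); last by ring.
by congr (_ || _); rewrite orbC.
Qed.

(** Replacing [a] by [- a] only exchanges the two translates in the recursion, so the problem
    depends on absolute values alone. *)
Lemma ssum_norm h s : ssum h [seq `|a| | a <- s] = ssum h s.
Proof.
elim: s h => [|a s IH] [|h] //; first by rewrite [LHS]IH.
apply/fsetP => x; rewrite [map _ _]/= !ssumS_cons !IH.
case: (ger0P a) => // _; rewrite opprK; congr (_ || _); apply: orbC.
Qed.

Lemma ssum_swap h a b s : ssum h [:: a, b & s] = ssum h [:: b, a & s].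
Proof.
case: h => [|h] //; apply/fsetP => x; rewrite !ssumS_cons.
case: h => [|h]; first by rewrite !ssum0; case: (_ \in _); do 4?case: (_ == _).
rewrite !ssumS_cons.
rewrite (addrAC x (- a) (- b)) (addrAC x (- a) b) (addrAC x a (- b)) (addrAC x a b).
by do 9?case: (_ \in _).
Qed.

Lemma ssum_eq_cons h a s t :
  (forall k, ssum k s = ssum k t) -> ssum h (a :: s) = ssum h (a :: t).
Proof. by move=> E; case: h => [|h]; rewrite /ssum -/ssum !E. Qed.

Lemma ssum_rem h a s : a \in s -> ssum h s = ssum h (a :: rem a s).
Proof.
elim: s h => [|b s IH] h //; rewrite inE /=.
have [-> _|_] := eqVneq b a; first by [].
move=> /= ain.
by rewrite ssum_swap; apply: ssum_eq_cons => k; apply: IH.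
Qed.

Lemma ssum_skip h a s x : x \in ssum h s -> x \in ssum h (a :: s).
Proof. by case: h => [|h]; rewrite ?ssum0 // ssumS_cons => ->. Qed.

Lemma ssum_add h a s x : x \in ssum h s -> x + a \in ssum h.+1 (a :: s).
Proof. by rewrite ssumS_cons addrK => ->; rewrite orbT. Qed.

Lemma ssum_sub h a s x : x \in ssum h s -> x - a \in ssum h.+1 (a :: s).
Proof. by rewrite ssumS_cons subrK => ->; rewrite !orbT. Qed.

Lemma ssum_all s : \sum_(a <- s) a \in ssum (size s) s.
Proof.
elim: s => [|a s IH]; first by rewrite big_nil ssum_nil.
by rewrite big_cons addrC ssum_add.
Qed.

Lemma ssum_cat h s t x : x \in ssum h s -> x \in ssum h (s ++ t).
Proof.
elim: s h x => [|a s IH] [|h] x; first by rewrite !ssum0.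
- by rewrite ssum_nil.
- by rewrite !ssum0.
by rewrite cat_cons !ssumS_cons => /or3P[] /IH ->; rewrite ?orbT.
Qed.

(** * Counting by residues modulo [2 * b] *)

Lemma leq_card_fset (X : {fset int}) (L : seq int) :
  uniq L -> {subset L <= X} -> (size L <= #|` X|)%N.
Proof. exact: uniq_leq_size. Qed.

(** Climbing from [x] by steps of [d] must leave the finite set [X]: each step that stays inside
    lowers the number of elements above. *)
Lemma ex_top (X : {fset int}) (d x : int) : 0 < d -> x \in X ->
  exists y, [/\ y \in X, y + d \notin X & (y = x %[mod d])%Z].
Proof.
move=> d0; have [n] := ubnP #|` [fset z in X | x < z]|.
elim: n x => // n IH x lt xX; have [xd|xd] := boolP (x + d \in X); last by exists x.
have [|y [y1 y2 y3]] := IH (x + d) _ xd.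
  rewrite -ltnS; apply: leq_trans lt; rewrite ltnS; apply: fproper_ltn_card.
  rewrite fproperE; apply/andP; split.
    by apply/fsubsetP; move=> z; rewrite !inE => /andP[-> /= ?]; lia.
  by apply/fsubsetPn; exists (x + d); rewrite !inE xd ?ltxx //=; lia.
by exists y; split=> //; rewrite y3 modzDr.
Qed.

(* The largest element [y] of [X] in each residue class satisfies [y + 2 b \notin X]. *)
Lemma card_shift2 (X Z : {fset int}) (b : int) (L : seq int) : 0 < b ->
    (forall x, x \in X -> (x + b \in Z) && (x - b \in Z)) ->
    {subset L <= X} -> uniq [seq (x %% (2 * b))%Z | x <- L] ->
  (#|` X| + size L <= #|` Z|)%N.
Proof.
move=> b0 XZ LX uL; pose d := 2 * b.
pose Y := [seq y <- enum_fset X | y + d \notin X].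
have LY : (size L <= size Y)%N.
  rewrite -(size_map (fun x => (x %% d)%Z) L) -(size_map (fun x => (x %% d)%Z) Y).
  apply: uniq_leq_size => // _ /mapP[x /LX xX ->].
  have [|y [yX yd yx]] := @ex_top X d x _ xX; first by rewrite /d; lia.
  by rewrite -yx; apply: map_f; rewrite mem_filter yd.
(* All of [X - b], plus [y + b] for the tops [y] of the classes; an equality [y + b = x - b] would
   put [y + 2 b] in [X]. *)
apply: (@leq_trans (size ([seq x - b | x <- enum_fset X] ++ [seq y + b | y <- Y]))).
  by rewrite size_cat !size_map leq_add2l.
apply: leq_card_fset.
  rewrite cat_uniq !map_inj_uniq ?fset_uniq ?filter_uniq ?fset_uniq //=;
    try by [apply: addIr].
  rewrite andbT; apply/hasPn => z /mapP[y]; rewrite mem_filter => /andP[yd _] ->.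
  apply: contra yd => /mapP[x xX e].
  by rewrite (_ : y + d = x) //; rewrite /d; lia.
move=> z; rewrite mem_cat => /orP[] /mapP[x]; last rewrite mem_filter => /andP[_].
  by move=> xX ->; have /andP[] := XZ _ xX.
by move=> xX ->; have /andP[] := XZ _ xX.
Qed.

(** * Full and nearly full sums *)

Lemma eqz_modP (d u v : int) : (u = v %[mod d])%Z -> exists q, u - v = q * d.
Proof. by move=> /eqP; rewrite eqz_mod_dvd => /dvdzP. Qed.

Lemma eqz_mod_small (d u v : int) : (u = v %[mod d])%Z -> `|u - v| < d -> u = v.
Proof.
move=> /eqz_modP[q e] lt; have d0 : 0 < d by lia.
move: lt; rewrite e normrM (gtr0_norm d0) -{2}(mul1r d) ltr_pM2r // => q1.
by have q0 : q = 0 by [lia]; move: e; rewrite q0 mul0r => e; lia.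
Qed.

Lemma uniq_mod_map (d : int) (f : int -> int) (L : seq int) : uniq L ->
    {in L &, forall x y, (f x = f y %[mod d])%Z -> x = y} ->
  uniq [seq (z %% d)%Z | z <- [seq f x | x <- L]].
Proof. by move=> uL inj; rewrite -map_comp map_inj_in_uniq. Qed.

Definition decr_pos (s : seq int) := sorted >%R s && all (fun x => 0 < x) s.

Lemma decr_pos_cons b s :
  decr_pos (b :: s) = [&& 0 < b, all (fun x => x < b) s & decr_pos s].
Proof.
rewrite /decr_pos /= path_sortedE; last by move=> x y z yx xz; apply: lt_trans xz yx.
by case: (all _ _); case: (0 < b); rewrite //= ?andbF.
Qed.

Lemma decr_pos_uniq s : decr_pos s -> uniq s.
Proof.
elim: s => //= b s IH; rewrite decr_pos_cons => /and3P[_ /allP sb /IH ->].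
by rewrite andbT; apply/negP => /sb; rewrite ltxx.
Qed.

Lemma decr_pos_gt0 s x : decr_pos s -> x \in s -> 0 < x.
Proof. by case/andP => _ /allP; apply. Qed.

Lemma sum_rem x (s : seq int) : x \in s -> \sum_(a <- s) a = x + \sum_(a <- rem x s) a.
Proof. by move=> xs; rewrite (big_rem x xs). Qed.

Lemma ssum_rem_all h x s y : x \in s -> y \in ssum h (rem x s) ->
  (y \in ssum h s) && (y - x \in ssum h.+1 s).
Proof. by move=> xs yin; rewrite !(ssum_rem _ xs) ssum_skip // ssum_sub. Qed.

Lemma size_rem1 x (s : seq int) : x \in s -> size s = (size (rem x s)).+1.
Proof. by move=> xs; rewrite size_rem //; case: s xs. Qed.

Lemma full_sub1 s x : x \in s -> \sum_(a <- s) a - 2 * x \in ssum (size s) s.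
Proof.
move=> xs; rewrite (size_rem1 xs) (sum_rem xs) (_ : _ - _ = \sum_(a <- rem x s) a - x).
  by have /andP[] := ssum_rem_all xs (ssum_all (rem x s)).
by ring.
Qed.

Lemma full_sub2 s x y : x \in s -> y \in rem x s ->
  \sum_(a <- s) a - 2 * x - 2 * y \in ssum (size s) s.
Proof.
move=> xs ys; rewrite (size_rem1 xs) (sum_rem xs).
set S := \sum_(a <- rem x s) a; rewrite (_ : _ - _ = S - 2 * y - x); last by ring.
by have /andP[] := ssum_rem_all xs (full_sub1 ys).
Qed.

(* The [0] may absorb one sign, so these are the signed sums of all the elements
   of [s] or of all but one. *)
Definition full_or_near (s : seq int) := ssum (size s) (0 :: s).

Lemma full_near s x : x \in ssum (size s) s -> x \in full_or_near s.
Proof. exact: ssum_skip. Qed.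

Lemma near_sub s x y : x \in s -> y \in ssum (size s).-1 (rem x s) -> y \in full_or_near s.
Proof.
move=> xs yin; rewrite /full_or_near (size_rem1 xs) -(addr0 y) ssum_add //.
by move: yin; rewrite (size_rem1 xs) => /(ssum_rem_all xs)/andP[].
Qed.

Lemma near_sub1 s x : x \in s -> \sum_(a <- s) a - x \in full_or_near s.
Proof.
move=> xs; apply: near_sub (xs) _; rewrite (size_rem1 xs) (sum_rem xs) addrC addKr.
exact: ssum_all.
Qed.

Lemma near_sub2 s x y : x \in s -> y \in rem x s ->
  \sum_(a <- s) a - x - 2 * y \in full_or_near s.
Proof.
move=> xs ys; apply: near_sub (xs) _; rewrite (size_rem1 xs) (sum_rem xs).
by rewrite (addrC x) addrK full_sub1.
Qed.

Lemma full_or_near_cons b s x : x \in full_or_near s ->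
  (x + b \in full_or_near (b :: s)) && (x - b \in full_or_near (b :: s)).
Proof. by move=> xin; rewrite /full_or_near ssum_swap ssum_add ?ssum_sub. Qed.

Lemma full_or_near_skip b s x : x \in ssum (size s) s -> x \in full_or_near (b :: s).
Proof.
by move=> xin; rewrite /full_or_near ssum_swap ssum_skip // -(addr0 x) ssum_add.
Qed.

(** Any two of these values differ by less than [2 * b], so congruence forces equality. *)
Lemma uniq_mod_sub2 (M b : int) (L : seq int) : uniq L ->
    (forall x, x \in L -> 0 <= x < b) ->
  uniq [seq (z %% (2 * b))%Z | z <- [seq M - 2 * x | x <- L]].
Proof.
move=> uL H; apply: uniq_mod_map uL _ => x y /H xb /H yb /eqz_mod_small E.
by have : M - 2 * x = M - 2 * y; [apply: E; lia | lia].
Qed.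

Lemma decr_pos_range b s : decr_pos (b :: s) ->
  uniq (0 :: s) /\ forall x, x \in 0 :: s -> 0 <= x < b.
Proof.
rewrite decr_pos_cons => /and3P[b0 /allP sb ds]; split.
  rewrite cons_uniq decr_pos_uniq // andbT; apply/negP => /(decr_pos_gt0 ds); by lia.
move=> x; rewrite inE => /orP[/eqP->|xs]; first by rewrite lexx.
by have := decr_pos_gt0 ds xs; have /= := sb _ xs; lia.
Qed.

Lemma full_sub_list s (L := [seq \sum_(a <- s) a - 2 * x | x <- 0 :: s]) :
  {subset L <= ssum (size s) s}.
Proof.
move=> _ /mapP[x + ->]; rewrite inE => /orP[/eqP->|]; last exact: full_sub1.
by rewrite mulr0 subr0 ssum_all.
Qed.

(** Adjoining a new maximum [b] to [s] gains at least [size s + 1] sums, since the total of [s] and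
    its single sign flips are distinct modulo [2 * b]. The bound [m (m + 1) / 2 + 1] is stated
    doubled. *)
Lemma card_full s : decr_pos s ->
  (size s * (size s).+1 + 2 <= 2 * #|` ssum (size s) s|)%N.
Proof.
elim: s => [|b s IH] ds; first by rewrite /= cardfs1.
have [us rs] := decr_pos_range ds; have := uniq_mod_sub2 (\sum_(a <- s) a) us rs.
move: ds; rewrite decr_pos_cons => /and3P[b0 sb ds] U.
have := @card_shift2 (ssum (size s) s) (ssum (size s).+1 (b :: s)) b _ b0 _ (full_sub_list (s := s)) U.
rewrite size_map /= => H.
have {}H : (#|` ssum (size s) s| + (size s).+1 <= #|` ssum (size s).+1 (b :: s)|)%N.
  by apply: H => x xin; rewrite ssum_add ?ssum_sub.
by move: (IH ds) H => /=; set c := #|` _|; set c1 := #|` _|; nia.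
Qed.

(* Adding [t = max s] modulo [b] amounts to subtracting [c = b - t], so the other
   elements of [s] descend to [0] by steps of [c]. *)
Lemma closed_mod_multiples (b : int) s : decr_pos (b :: s) -> (3 <= size s)%N ->
    (forall x y, x \in s -> y \in s -> x != y -> x + y \in s \/ x + y - b \in 0 :: s) ->
  exists c, [/\ c \in s, 3 * c \in s & forall x, x \in s -> exists q, x = q * c].
Proof.
move=> db ss cl; have [us rs] := decr_pos_range db.
case: s => [|t [|y [|z s]]] // in db ss cl us rs *.
move: db; rewrite !decr_pos_cons => /and5P[b0 tb t0 yt /and5P[y0 zy z0 sz ds]].
have {tb} tb : t < b by have := rs t; rewrite !inE eqxx; lia.
have {}yt x : x \in [:: y, z & s] -> x < t by move/(allP yt).
have {}zy x : x \in z :: s -> x < y by move/(allP zy).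
pose c := b - t.
have pos x : x \in [:: t, y, z & s] -> 0 < x.
  move=> xs; have := rs x; rewrite inE xs orbT => /(_ isT) xb.
  have : x != 0 by apply: contraL xs => /eqP ->; move: us; rewrite cons_uniq => /andP[].
  by lia.
(* Closure for [x] and [t]: [x + t] exceeds the maximum [t], so [x + t - b = x - c] lies in the list
   or is [0]. *)
have cl1 x : x \in [:: y, z & s] -> x != c -> x - c \in [:: y, z & s].
  move=> xs xc; have xt := yt _ xs; have xs' : x \in [:: t, y, z & s] by rewrite inE xs orbT.
  have xt' : x != t by lia.
  have [|] := cl x t xs' (mem_head _ _) xt'.
  - by have := pos x xs'; rewrite inE => ? /orP[/eqP|/yt]; lia.
  - rewrite (_ : x + t - b = x - c); last by rewrite /c; ring.
    rewrite inE subr_eq0 (negPf xc) /= inE => /orP[/eqP|//].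
    by have := pos x xs'; rewrite /c; lia.
have cge x : x \in [:: y, z & s] -> c <= x.
  move=> xs; have [->//|/(cl1 _ xs) h] := eqVneq x c.
  by have := pos (x - c); rewrite inE h orbT => /(_ isT); lia.
(* Descent by [c] stays among the positive elements, so it can only stop at [c]. *)
have mult x : x \in [:: y, z & s] -> c \in [:: y, z & s] /\ exists q, x = q * c.
  have [n] := ubnP (absz x); elim: n x => // n IH x xn xs.
  have [<-|xc] := eqVneq x c; first by split=> //; exists 1; rewrite mul1r.
  have xcs := cl1 _ xs xc.
  have h0 : 0 < x - c by apply: pos; rewrite inE xcs orbT.
  have [|cs [q e]] := IH (x - c) _ xcs; first by rewrite /c in h0 *; lia.
  by split=> //; exists (q + 1); rewrite mulrDl -e mul1r subrK.
have ys : y \in [:: y, z & s] by rewrite inE eqxx.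
have zs : z \in [:: y, z & s] by rewrite !inE eqxx orbT.
have [cs [qy ey]] := mult y ys.
have yc : c < y by have := cge z zs; have := zy z; rewrite inE eqxx => /(_ isT); lia.
(* Closure for [y] and [c]: [y + c - b = y - t] is negative, so [y + c] is in the list; being larger
   than [y], it is [t]. *)
have tE : t = y + c.
  have ys' : y \in [:: t, y, z & s] by rewrite inE ys orbT.
  have cs' : c \in [:: t, y, z & s] by rewrite inE cs orbT.
  have yc' : y != c by lia.
  have [|] := cl y c ys' cs' yc'.
  - rewrite inE => /orP[/eqP->//|]; rewrite inE => /orP[/eqP|/zy]; last by lia.
    by have := cge z zs; have := pos z; rewrite inE zs orbT => /(_ isT); lia.
  - have := yt y ys; rewrite inE => ? /orP[/eqP|/pos]; rewrite /c; lia.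
exists c; split; first by rewrite inE cs orbT.
- have D x : x \in [:: t, y, z & s] -> x != c -> x - c \in [:: t, y, z & s].
    rewrite inE => /orP[/eqP-> _|xs xc]; first by rewrite tE addrK inE ys orbT.
    by rewrite inE cl1 ?orbT.
  have mt x : x \in [:: t, y, z & s] -> exists q, x = q * c.
    rewrite inE => /orP[/eqP->|/mult[]//]; exists (qy + 1).
    by rewrite tE {1}ey; ring.
  have c0 : 0 < c by rewrite /c; lia.
  (* Descent by [c] through multiples of [c] cannot jump over [3 * c]; it starts at [t = y + c],
     where [y] is at least [2 * c]. *)
  have R x : x \in [:: t, y, z & s] -> 3 * c <= x -> 3 * c \in [:: t, y, z & s].
    have [n] := ubnP (absz x); elim: n x => // n IH x xn xs x3.
    have [<-//|xc] := eqVneq x (3 * c).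
    have xs' := D x xs; have {xs'} xs' : x - c \in [:: t, y, z & s] by apply: xs'; lia.
    apply: IH xs' _; first by lia.
    have [q e] := mt x xs; rewrite e in x3 xc *.
    have q3 : 3 < q by nia.
    by nia.
  apply: (R t); first by rewrite inE eqxx.
  have : 1 < qy by nia.
  by rewrite tE ey; nia.
- move=> x; rewrite inE => /orP[/eqP->|/mult[]//]; exists (qy + 1).
  by rewrite tE {1}ey; ring.
Qed.

(** * Adjoining a maximum to a list with an odd element *)

Lemma odd_modz2 (x : int) : (x %% 2)%Z = 1 -> exists q, x = 2 * q + 1.
Proof. by move=> e; exists (x %/ 2)%Z; rewrite {1}(divz_eq x 2) e mulrC. Qed.

(** The classes of [M - 2 * x] and [M - o - 2 * x] fall one short of the number needed; [e] is the
    missing one. It is chosen together with [o], as the second case needs a particular odd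
    element. *)
Lemma extra_residue b s (M := \sum_(a <- s) a) :
    decr_pos (b :: s) -> (3 <= size s)%N -> has (fun x => (x %% 2)%Z == 1) s ->
  exists o e, [/\ o \in s, (o %% 2)%Z = 1, e \in full_or_near s,
    forall x, x \in 0 :: s -> (e <> M - 2 * x %[mod 2 * b])%Z &
    forall x, x \in 0 :: rem o s -> (e <> M - o - 2 * x %[mod 2 * b])%Z].
Proof.
move=> db ss /hasP[o os /eqP oo]; have [us rs] := decr_pos_range db.
have [q oE] := odd_modz2 oo.
pose bad x y := (x != y) && all (fun z => ~~ (b %| x + y - z)%Z) (0 :: s).
have [/hasP[x xs /hasP[y ys /andP[xy /allP xyz]]]|/hasPn good] :=
    boolP (has (fun x => has (bad x) s) s).
  (* Here [x + y] is congruent modulo [b] to nothing in [0 :: s], so flipping both signs gives a new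
     class; parity separates it from the classes shifted by [o]. *)
  exists o, (M - 2 * x - 2 * y); split=> //.
  - apply/full_near/full_sub2 => //; rewrite mem_rem_uniq ?inE 1?eq_sym ?xy //.
    by move: us; rewrite cons_uniq => /andP[].
  - move=> z /xyz /negP zb /eqz_modP[k e]; apply: zb; apply/dvdzP; exists (- k).
    by move: e; lia.
  - by move=> z _ /eqz_modP[k]; rewrite oE; lia.
have [x y xs ys xy|c [cs c3s mc]] := closed_mod_multiples db ss.
  have /hasPn/(_ y ys) := good x xs; rewrite /bad xy andTb -has_predC.
  have xr : 0 < x < b.
    have := rs x; rewrite inE xs orbT => /(_ isT).
    have : x != 0 by apply: contraL xs => /eqP ->; move: us; rewrite cons_uniq => /andP[].
    by lia.
  have yr : 0 < y < b.
    have := rs y; rewrite inE ys orbT => /(_ isT).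
    have : y != 0 by apply: contraL ys => /eqP ->; move: us; rewrite cons_uniq => /andP[].
    by lia.
  move=> /hasP[z zs /negPn/dvdzP[k e]].
  have zr := rs z zs.
  have k01 : k = 0 \/ k = 1 by nia.
  case: k01 e => ->; rewrite ?mul0r ?mul1r => e.
    have zE : z = x + y by lia.
    left; move: zs; rewrite inE zE => /orP[/eqP|//]; by lia.
  by right; rewrite (_ : _ - b = z) //; lia.
have [j oj] := mc o os.
have c2 : (c %% 2)%Z = 1.
  have [|//] : (c %% 2)%Z = 0 \/ (c %% 2)%Z = 1 by lia.
  by move=> c0; move: oo; rewrite oj (divz_eq c 2) c0 addr0 mulrA modzMl.
have [r cE] := odd_modz2 c2.
(* [c] is odd because its multiple [o] is. Leaving out the element [3 * c] gives [M - c - 2 * c],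
   the value at the excluded [x = c] of the family [M - c - 2 * x]. *)
exists c, (M - 3 * c); split=> //.
- exact: near_sub1.
- by move=> z _ /eqz_modP[k]; rewrite cE; lia.
- have cr : 0 <= c < b by apply: rs; rewrite inE cs orbT.
  have cn0 : c != 0 by lia.
  move=> x xin /eqz_mod_small E.
  have xc : x != c.
    move: xin; rewrite inE mem_rem_uniq; last by move: us; rewrite cons_uniq => /andP[].
    by rewrite !inE => /orP[/eqP->|/andP[]//]; rewrite eq_sym.
  have xr : 0 <= x < b by apply: rs; move: xin; rewrite !inE => /orP[->//|/mem_rem->]; rewrite orbT.
  have : M - 3 * c = M - c - 2 * x by apply: E; lia.
  by lia.
Qed.

Lemma card_step_odd b s :
    decr_pos (b :: s) -> (3 <= size s)%N -> has (fun x => (x %% 2)%Z == 1) s ->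
  (#|` full_or_near s| + 2 * (size s).+1 <= #|` full_or_near (b :: s)|)%N.
Proof.
move=> db ss hs; have [o [e [os oo epp e1 e2]]] := extra_residue db ss hs.
have [us rs] := decr_pos_range db; pose M := \sum_(a <- s) a.
have [q oE] := odd_modz2 oo.
have b0 : 0 < b by move: db; rewrite decr_pos_cons => /and3P[].
have sub x : x \in 0 :: rem o s -> x \in 0 :: s.
  by rewrite !inE => /orP[->//|/mem_rem->]; rewrite orbT.
have ur : uniq (0 :: rem o s).
  move: us; rewrite !cons_uniq => /andP[n0 us]; rewrite rem_uniq // andbT.
  by apply: contra n0; apply: mem_rem.
(* [E] consists of full sums, [O] of sums leaving out [o]; as [o] is odd they have opposite parities
   and share no class. *)
pose E := [seq M - 2 * x | x <- 0 :: s].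
pose O := [seq M - o - 2 * x | x <- 0 :: rem o s].
have -> : (2 * (size s).+1 = size (e :: E ++ O))%N.
  rewrite /E /O /= size_cat /= !size_map (size_rem os) prednK; last by case: (s) os.
  by rewrite mul2n -addnn addSn addnS.
apply: card_shift2 b0 _ _ _; first by move=> x; apply: full_or_near_cons.
- move=> x; rewrite inE mem_cat => /or3P[/eqP->//|/mapP[y ys ->]|/mapP[y ys ->]].
    by apply: full_near; apply: full_sub_list; apply: (map_f (fun x => M - 2 * x) ys).
  move: ys; rewrite inE => /orP[/eqP->|ys]; last exact: near_sub2.
  by rewrite mulr0 subr0 near_sub1.
rewrite map_cons map_cat cons_uniq mem_cat cat_uniq !uniq_mod_sub2 //; last by move=> x /sub/rs.
rewrite andbT andTb negb_or -andbA; apply/and3P; split.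
- by apply/mapP => -[z /mapP[x xs ->]]; apply: e1.
- by apply/mapP => -[z /mapP[x xs ->]]; apply: e2.
- apply/hasPn => _ /mapP[_ /mapP[x xs ->] ->]; apply/mapP => -[_ /mapP[y ys ->]].
  by move=> /eqz_modP[k]; rewrite oE; lia.
Qed.

(** * Even elements: divisibility and scaling *)

Lemma ssum_dvd (d : int) h s x :
  all (dvdz d) s -> x \in ssum h s -> (d %| x)%Z.
Proof.
elim: s h x => [|a s IH] [|h] x; rewrite ?ssum0 ?ssum_nil //.
- by move=> _ /eqP->; apply: dvdz0.
- by move=> _ /eqP->; apply: dvdz0.
case/andP=> da ds; rewrite ssumS_cons => /or3P[]; first exact: IH.
- by move/(IH _ _ ds); rewrite (rpredBr _ da).
- by move/(IH _ _ ds); rewrite (rpredDr _ da).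
Qed.

Lemma ssum_scale (d : int) h s x : x \in ssum h s -> d * x \in ssum h [seq d * a | a <- s].
Proof.
elim: s h x => [|a s IH] [|h] x.
- by rewrite !ssum0 => /eqP->; rewrite mulr0.
- by rewrite ssum_nil.
- by rewrite !ssum0 => /eqP->; rewrite mulr0.
by rewrite map_cons !ssumS_cons -mulrBr -mulrDr => /or3P[] /IH ->; rewrite ?orbT.
Qed.

Lemma card_full_or_near_scale (d : int) s : d != 0 ->
  (#|` full_or_near s| <= #|` full_or_near [seq (d * a)%R | a <- s]|)%N.
Proof.
move=> d0; rewrite -(size_map (fun x => d * x) (full_or_near s)).
apply: leq_card_fset; first by rewrite map_inj_uniq ?fset_uniq //; apply: mulfI.
move=> _ /mapP[x xs ->]; rewrite /full_or_near size_map.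
by have := ssum_scale d xs; rewrite map_cons mulr0.
Qed.

(** All translates by [b] or [- b] are odd, while the full sums of [s], which leave [b] out, are
    even; so the shift count takes place outside the latter. *)
Lemma card_step_even b s :
    decr_pos (b :: s) -> all (dvdz 2) s -> ~~ (2 %| b)%Z ->
  (#|` full_or_near s| + (size s).+1 + #|` ssum (size s) s| <= #|` full_or_near (b :: s)|)%N.
Proof.
move=> db s2 b2; have [us rs] := decr_pos_range db.
have b0 : 0 < b by move: db; rewrite decr_pos_cons => /and3P[].
have sub : ssum (size s) s `<=` full_or_near (b :: s).
  by apply/fsubsetP => x; apply: full_or_near_skip.
have f2 x : x \in full_or_near s -> (2 %| x)%Z.
  exact: ssum_dvd.
have H x : x \in full_or_near s ->
    (x + b \in full_or_near (b :: s) `\` ssum (size s) s) &&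
    (x - b \in full_or_near (b :: s) `\` ssum (size s) s).
  move=> xs; have /andP[xp xm] := full_or_near_cons b xs.
  rewrite !in_fsetD xp xm !andbT; apply/andP; split.
    by apply: contra b2 => /(ssum_dvd s2); rewrite (rpredDl _ (f2 _ xs)).
  by apply: contra b2 => /(ssum_dvd s2); rewrite (rpredBl _ (f2 _ xs)).
have U := uniq_mod_sub2 (\sum_(a <- s) a) us rs.
have L x : x \in [seq \sum_(a <- s) a - 2 * x | x <- 0 :: s] -> x \in full_or_near s.
  by move=> /full_sub_list/full_near.
have := card_shift2 b0 H L U; rewrite cardfsDS // size_map => C.
by rewrite -(subnK (fsubset_leq_card sub)) leq_add2r.
Qed.

(** * Sums given by explicit coefficient words *)

Definition ternary_sum (l s : seq int) := \sum_(p <- zip l s) p.1 * p.2.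

Lemma ssum_ternary (l s : seq int) : size l = size s -> {subset l <= [:: -1; 0; 1]} ->
  ternary_sum l s \in ssum (count (predC1 0) l) s.
Proof.
rewrite /ternary_sum; elim: s l => [|a s IH] [|e l] //=; first by rewrite big_nil ssum_nil.
move=> [sz] le.
rewrite big_cons addrC; have {}IH := IH l sz.
have /IH {}IH : {subset l <= [:: -1; 0; 1]} by move=> x xl; apply: le; rewrite inE xl orbT.
have : e \in [:: -1; 0; 1] by apply: le; rewrite inE eqxx.
rewrite !inE => /or3P[] /eqP-> /=.
- by rewrite mulN1r ssum_sub.
- by rewrite mul0r addr0 ssum_skip.
- by rewrite mul1r ssum_add.
Qed.

(** Signed sums come in opposite pairs, so positive ones count twice and [0] once. *)
Lemma card_ssum_pos h s (L : seq int) : uniq L -> {in L, forall x, 0 < x} ->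
  {subset L <= ssum h s} -> (2 * size L + (0%R \in ssum h s) <= #|` ssum h s|)%N.
Proof.
move=> uL pL sL; set z := (_ \in _ : bool).
have -> : (2 * size L + z = size (nseq z (0 : int) ++ L ++ [seq - x | x <- L]))%N.
  by rewrite !size_cat size_nseq size_map addnn mul2n addnC.
apply: leq_card_fset; last first.
  move=> x; rewrite !mem_cat => /or3P[|/sL//|/mapP[y /sL ys ->]]; last by rewrite ssum_oppr.
  by rewrite mem_nseq /z => /andP[+ /eqP->]; case: (0 \in _).
rewrite !cat_uniq uL map_inj_uniq ?uL //; last exact: oppr_inj.
rewrite andbT /=; apply/and3P; split; first by case: z.
- apply/hasPn => x; rewrite mem_cat mem_nseq => xs; apply/negP => /andP[_ /eqP x0].
  by move: xs; rewrite x0 => /orP[/pL//|/mapP[y /pL y0]]; lia.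
- by apply/hasPn => _ /mapP[x /pL x0 ->]; apply/negP => /pL; lia.
Qed.

(** * Three and four elements *)

Definition ternary_words (h n : nat) (Ls : seq (seq int)) :=
  all (fun l => [&& size l == n, count (predC1 0) l == h & all (mem [:: -1; 0; 1]) l]) Ls.

Lemma ternary_words_sub h s Ls : ternary_words h (size s) Ls ->
  {subset [seq ternary_sum l s | l <- Ls] <= ssum h s}.
Proof.
move=> /allP H _ /mapP[l /H /and3P[/eqP sl /eqP <- /allP ml] ->].
exact: ssum_ternary.
Qed.

Lemma card_ssum_words h s Ls (vs := [seq ternary_sum l s | l <- Ls]) :
    ternary_words h (size s) Ls -> uniq vs && all (fun x => 0 < x) vs ->
  (2 * size Ls + (0%R \in ssum h s) <= #|` ssum h s|)%N.
Proof.
move=> tw /andP[uv /allP pv]; rewrite -(size_map (fun l => ternary_sum l s) Ls).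
by apply: card_ssum_pos => //; apply: ternary_words_sub.
Qed.

Lemma ternary_sum_cons e l a s : ternary_sum (e :: l) (a :: s) = e * a + ternary_sum l s.
Proof. by rewrite /ternary_sum /= big_cons. Qed.

Lemma ternary_sum_nil : ternary_sum [::] [::] = 0.
Proof. by rewrite /ternary_sum big_nil. Qed.

Definition ternaryE := (ternary_sum_cons, ternary_sum_nil).

(** 13 is [m (m + 1) + 1] for [m = 3]. It is reached by seven positive sums, or by six and [0]; the
    first letter of each word is the coefficient of the absorbing [0]. *)
Lemma full_or_near3 (a b c : int) : 0 < a -> a < b -> b < c ->
  (13 <= #|` full_or_near [:: c; b; a]|)%N \/
  [/\ b = 2 * a, c = 4 * a & (12 <= #|` full_or_near [:: c; b; a]|)%N].
Proof.
move=> a0 ab bc; pose s := [:: 0; c; b; a].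
have W Ls := @card_ssum_words 3 s Ls.
(* The first seven words can collide only through [c + b - a = c + a] or [c - a = c - b + a], both
   equivalent to [b = 2 * a]. *)
have [bE|b2] := eqVneq b (2 * a); last first.
  left; apply: leq_trans (W [:: [:: 0; 1; 1; 1]; [:: 1; 1; 1; 0]; [:: 1; 1; 0; 1];
    [:: 0; 1; 1; -1]; [:: 0; 1; -1; 1]; [:: 1; 1; 0; -1]; [:: 1; 1; -1; 0]] _ _) => //.
  by rewrite /= !ternaryE !inE; lia.
have [cE|c3] := eqVneq c (3 * a).
  (* Now [c - b - a = 0], so six positive words suffice. *)
  left; have z : 0%R \in ssum 3 s.
    have := @ternary_words_sub 3 s [:: [:: 0; 1; -1; -1]]; apply => //.
    by rewrite /= !ternaryE !inE; lia.
  have := W [:: [:: 0; 1; 1; 1]; [:: 1; 1; 1; 0]; [:: 1; 1; 0; 1];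
    [:: 1; 0; 1; 1]; [:: 1; 1; 0; -1]; [:: 1; 1; -1; 0]]; rewrite z; apply => //.
  by rewrite /= !ternaryE !inE; lia.
have [cE|c4] := eqVneq c (4 * a).
  right; split=> //; apply: leq_trans (W [:: [:: 0; 1; 1; 1]; [:: 1; 1; 1; 0]; [:: 1; 1; 0; 1];
    [:: 1; 1; 0; -1]; [:: 1; 1; -1; 0]; [:: 1; 0; 1; -1]] _ _) => //.
  by rewrite /= !ternaryE !inE; lia.
left; have [lt|ge] := ltrP c (3 * a).
  apply: leq_trans (W [:: [:: 0; 1; 1; 1]; [:: 1; 1; 1; 0]; [:: 1; 1; 0; 1];
    [:: 1; 1; 0; -1]; [:: 1; 1; -1; 0]; [:: 1; 0; 1; -1]; [:: 1; 0; 1; 1]] _ _) => //.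
  by rewrite /= !ternaryE !inE; lia.
apply: leq_trans (W [:: [:: 0; 1; 1; 1]; [:: 1; 1; 1; 0]; [:: 1; 1; 0; 1];
  [:: 1; 1; 0; -1]; [:: 1; 1; -1; 0]; [:: 1; 0; 1; -1]; [:: 0; 1; -1; -1]] _ _) => //.
by rewrite /= !ternaryE !inE; lia.
Qed.

Lemma eqz_mod_small2 (d u v : int) : (u = v %[mod d])%Z -> `|u - v| < 2 * d ->
  [\/ u = v, u = v + d | u = v - d].
Proof.
move=> /eqz_modP[q e] lt; have d0 : 0 < d by lia.
move: lt; rewrite e normrM (gtr0_norm d0) ltr_pM2r // => q1.
have : [\/ q = 0, q = 1 | q = -1].
  case: (ltrgt0P q) q1 => q0 q1; [constructor 2|constructor 3|constructor 1]; lia.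
by case=> qE; move: e; rewrite qE ?mul0r ?mul1r ?mulN1r => e;
  [constructor 1|constructor 2|constructor 3]; lia.
Qed.

(* Having 12 instead of 13 sums for three elements is made up for by nine residues
   instead of eight; there would be only eight if [2 b = 9 a]. *)
Lemma card_step_124 (a b : int) : 0 < a -> (a %% 2)%Z = 1 -> 4 * a < b ->
  (21 <= #|` full_or_near [:: b; 4 * a; 2 * a; a]%R|)%N.
Proof.
move=> a0 /odd_modz2[r aE] ab; pose s := [:: 4 * a; 2 * a; a].
have c12 : (12 <= #|` full_or_near s|)%N.
  have h2 : a < 2 * a by lia.
  have h4 : 2 * a < 4 * a by lia.
  by case: (full_or_near3 a0 h2 h4) => [/ltnW|[]].
(* As [2 * b > 8 * a], multipliers from the second list collide only if they differ by 9 or 10. A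
   difference of 9 needs [2 * b = 9 * a], excluded by parity; 10 needs [b = 5 * a], and then [-3],
   equal to [7] modulo 10, is replaced by [-6]. *)
pose C := if b == 5 * a then [:: 7; 6; 5; 3; 2; 1; -1; -2; -6]
          else [:: 7; 6; 5; 3; 2; 1; -1; -2; -3] : seq int.
have sub (j : int) : j \in [:: 7; 6; 5; 3; 2; 1] -> j * a \in full_or_near s.
  move=> jin; have := @ternary_words_sub 3 (0 :: s) [:: [:: 0; 1; 1; 1]; [:: 1; 1; 1; 0];
    [:: 1; 1; 0; 1]; [:: 1; 0; 1; 1]; [:: 1; 1; -1; 0]; [:: 1; 0; 1; -1]] isT (j * a).
  apply; move: jin; rewrite /= !ternaryE !inE.
  by do 5?[case/orP => [/eqP->|]]; first [by move/eqP->; lia | lia].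
have subC : {subset [seq j * a | j <- C] <= full_or_near s}.
  move=> _ /mapP[j jC ->].
  have : j \in [:: 7; 6; 5; 3; 2; 1] \/ - j \in [:: 7; 6; 5; 3; 2; 1].
    by move: jC; rewrite /C; case: ifP => _; rewrite !inE; lia.
  by case=> [/sub//|/sub]; rewrite mulNr /full_or_near ssum_oppr.
have b0 : 0 < b by lia.
have sC : size C = 9 by rewrite /C; case: ifP.
suff U : uniq [seq (z %% (2 * b))%Z | z <- [seq j * a | j <- C]].
  have := card_shift2 b0 (@full_or_near_cons b s) subC U; rewrite size_map sC => le.
  by apply: leq_trans le; rewrite -[21%N]/(12 + 9)%N leq_add2r.
apply: uniq_mod_map; first by rewrite /C; case: ifP.
have rng j : j \in C -> -6 <= j <= 7 by rewrite /C; case: ifP => _; rewrite !inE; lia.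
move=> i j iC jC /eqz_mod_small2 D.
have : [\/ i * a = j * a, i * a = j * a + 2 * b | i * a = j * a - 2 * b].
  by apply: D; have := rng i iC; have := rng j jC; nia.
case=> [/(mulIf _)->//|e|e]; first by lia.
  by move: iC jC e; rewrite /C; case: ifP => /eqP b5; rewrite !inE;
    do 8?[case/orP => [/eqP->|]]; try move/eqP->;
    do 8?[case/orP => [/eqP->|]]; try move=> /eqP->; lia.
by move: iC jC e; rewrite /C; case: ifP => /eqP b5; rewrite !inE;
  do 8?[case/orP => [/eqP->|]]; try move/eqP->;
  do 8?[case/orP => [/eqP->|]]; try move=> /eqP->; lia.
Qed.

(** * The lower bound for positive elements *)

Lemma decr_pos_scale (d : int) s : 0 < d -> decr_pos [seq d * a | a <- s] = decr_pos s.
Proof.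
move=> d0; elim: s => //= a s IH; rewrite !decr_pos_cons IH pmulr_rgt0 //.
by congr [&& _, _ & _]; rewrite all_map; apply: eq_all => x; rewrite /= ltr_pM2l.
Qed.

Lemma sum_pos_ge0 s : decr_pos s -> 0 <= \sum_(a <- s) a.
Proof.
by move=> ds; rewrite big_seq; apply: sumr_ge0 => x /(decr_pos_gt0 ds)/ltW.
Qed.

Lemma all_dvd_scale (d : int) s : all (dvdz d) s -> exists t, s = [seq d * a | a <- t].
Proof.
elim: s => [|a s IH]; first by exists [::].
by case/andP => /dvdzP[q ->] /IH[t ->]; exists (q :: t); rewrite /= mulrC.
Qed.

(** Strong induction on the sum of [s], which drops both when the maximum is removed and when all
    elements are halved. *)
Lemma card_full_or_near s : decr_pos s -> (4 <= size s)%N ->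
  (size s * (size s).+1 + 1 <= #|` full_or_near s|)%N.
Proof.
have [n] := ubnP `|(\sum_(a <- s) a)%R|%N; elim: n s => // n IH [|b s] // lt db ss.
have := db; rewrite decr_pos_cons => /and3P[b0 sb ds].
have s0 := sum_pos_ge0 ds.
have {IH} IH t : decr_pos t -> (4 <= size t)%N -> \sum_(a <- t) a < b + \sum_(a <- s) a ->
    (size t * (size t).+1 + 1 <= #|` full_or_near t|)%N.
  move=> dt t4 tlt; apply: IH => //; rewrite ltnS big_cons in lt.
  have S0 : 0 <= b + \sum_(a <- s) a by rewrite addr_ge0 // ltW.
  rewrite -ltz_nat gez0_abs ?sum_pos_ge0 //; apply: lt_le_trans tlt _.
  by rewrite -(gez0_abs S0) lez_nat.
have IHs : (4 <= size s)%N -> (size s * (size s).+1 + 1 <= #|` full_or_near s|)%N.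
  by move=> s4; apply: IH => //; lia.
have {}ss : (3 <= size s)%N by [].
have [hs|] := boolP (has (fun x => (x %% 2)%Z == 1) s).
  have := card_step_odd db ss hs; have [s4|s3] := leqP 4 (size s).
    by have := IHs s4; rewrite /=; set u := #|` _|; set v := #|` _|; nia.
  case: s => [|c [|b' [|a [|]]]] // in db b0 sb ds s0 IH IHs ss hs s3 lt *.
  move: (ds) sb; rewrite !decr_pos_cons /= !andbT => /and5P[c0 /andP[bc ac] b'0 ab a0].
  case/and3P => cb _ _ le; case: (full_or_near3 a0 ab bc) => [le2|[bE cE _]].
    by apply: leq_trans le; rewrite -[(_ * _ + 1)%N]/(13 + 8)%N leq_add2r.
  rewrite bE cE; apply: card_step_124 => //; last by rewrite -cE.
  move: hs; rewrite /= bE cE; have : (a %% 2)%Z = 0 \/ (a %% 2)%Z = 1 by lia.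
  by lia.
rewrite -all_predC => /allP ev; have {}ev : all (dvdz 2) s.
  by apply/allP => x /ev /= /eqP xo; apply/dvdz_mod0P; lia.
have [b2|b2] := boolP (2 %| b)%Z.
  have [|t tE] := @all_dvd_scale 2 (b :: s); first by apply/andP.
  rewrite tE; apply: leq_trans (card_full_or_near_scale _ _) => //.
  rewrite size_map; apply: IH; first by rewrite -(@decr_pos_scale 2) // -tE.
    by rewrite -(size_map (fun a : int => 2 * a)) -tE.
  have := congr1 (fun u : seq int => \sum_(a <- u) a) tE.
  rewrite big_map -big_distrr big_cons => E; have : 0 < b + \sum_(a <- s) a by rewrite ltr_pwDl.
  by rewrite E /=; move: (\sum_(a <- t) a) => T; lia.
have := card_step_even db ev b2; have := card_full ds.
have [s4|s3] := leqP 4 (size s).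
  have := IHs s4; rewrite /=; set u := #|` _|; set v := #|` _|; set w := #|` _|; nia.
case: s => [|c [|b' [|a [|]]]] // in db b0 sb ds s0 IH IHs ss s3 lt ev *.
move: (ds) sb; rewrite !decr_pos_cons /= !andbT => /and5P[c0 /andP[bc ac] b'0 ab a0] _.
(* Even the exceptional triple is enough here: [12 + 4 + 7] exceeds the required 21. *)
have : (12 <= #|` full_or_near [:: c; b'; a]|)%N.
  by case: (full_or_near3 a0 ab bc) => [/ltnW|[]].
by set u := #|` _|; set v := #|` _|; set w := #|` _|; lia.
Qed.

(** * Removing the largest element *)

Definition top_sum (h : nat) (s : seq int) := \sum_(a <- take h s) a.

Lemma top_sum_le h s : decr_pos s -> top_sum h s <= top_sum h.+1 s.
Proof.
elim: s h => [|a s IH] h; first by rewrite /top_sum.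
rewrite decr_pos_cons /top_sum => /and3P[a0 _ ds]; case: h => [|h].
  by rewrite /= take0 !big_cons big_nil addr0 ltW.
by rewrite /= !big_cons lerD2l; apply: IH.
Qed.

Lemma top_sum_cons_ge h a s : decr_pos (a :: s) -> top_sum h s <= top_sum h (a :: s).
Proof.
elim: s h a => [|b s IH] h a ds; case: h => [|h]; rewrite /top_sum ?take0 //=.
  by move: ds; rewrite decr_pos_cons big_nil big_cons big_nil => /and3P[]; lia.
rewrite !big_cons; move: ds; rewrite decr_pos_cons => /and3P[_ /andP[ba _] ds].
by apply: lerD; [apply: ltW | apply: IH].
Qed.

Lemma ssum_bound h s x : decr_pos s -> x \in ssum h s -> `|x| <= top_sum h s.
Proof.
elim: s h x => [|a s IH] [|h] x ds.
- by rewrite ssum0 => /eqP->; rewrite /top_sum big_nil.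
- by rewrite ssum_nil.
- by rewrite ssum0 => /eqP->; rewrite /top_sum take0 big_nil.
have := top_sum_cons_ge h.+1 ds; have : top_sum h.+1 (a :: s) = a + top_sum h s by rewrite /top_sum big_cons.
move: ds; rewrite decr_pos_cons => /and3P[a0 _ ds] E le.
rewrite ssumS_cons => /or3P[/(IH _ _ ds)|/(IH _ _ ds)|/(IH _ _ ds)]; lia.
Qed.

Lemma ssum_cons0 h s x :
  (x \in ssum h.+1 (0 :: s)) = (x \in ssum h.+1 s) || (x \in ssum h s).
Proof. by rewrite ssumS_cons subr0 ?addr0 orbb. Qed.

Lemma ssum0_bound h s x : decr_pos s -> x \in ssum h (0 :: s) -> `|x| <= top_sum h s.
Proof.
case: h => [|h] ds; first by rewrite ssum0_cons; apply: ssum_bound.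
rewrite ssum_cons0 => /orP[/(ssum_bound ds)//|/(ssum_bound ds) le].
exact: le_trans le (top_sum_le _ ds).
Qed.

(** Replacing one of the [h] largest elements of [s] by [b] gives a sum above every sum for [s];
    these [h] sums and their opposites are new. *)
Lemma card_step_top h b s : decr_pos (b :: s) -> (h <= size s)%N ->
  (#|` ssum h (0%R :: s)| + 2 * h <= #|` ssum h [:: 0%R, b & s]|)%N.
Proof.
case: h => [|h] db hs; first by rewrite !ssum0_cons addn0.
have := db; rewrite decr_pos_cons => /and3P[b0 /allP sb ds].
pose u := take h.+1 s; have su : size u = h.+1 by rewrite size_takel.
pose N := [seq b + (top_sum h.+1 s - y) | y <- u].
have us x : x \in u -> x \in s by apply: mem_take.
have topE : top_sum h.+1 s = \sum_(a <- u) a by [].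
have Nmem z : z \in N -> z \in ssum h.+1 (0 :: b :: s).
  case/mapP => y yu ->; rewrite ssum_cons0; apply/orP; left.
  rewrite addrC ssum_add // topE (sum_rem yu) addrC addKr -(cat_take_drop h.+1 s) ssum_cat //.
  rewrite (ssum_rem _ yu) ssum_skip //.
  have -> : h = size (rem y u) by apply: succn_inj; rewrite -su; apply: size_rem1.
  exact: ssum_all.
have Ngt z : z \in N -> top_sum h.+1 s < z.
  by case/mapP => y /us/sb /= yb ->; lia.
have t0 : 0 <= top_sum h.+1 s.
  by rewrite topE big_seq; apply: sumr_ge0 => x /us/(decr_pos_gt0 ds)/ltW.
have -> : (#|` ssum h.+1 (0%R :: s)| + 2 * h.+1 =
    size (enum_fset (ssum h.+1 (0%R :: s)) ++ N ++ [seq (- z)%R | z <- N]))%N.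
  by rewrite !size_cat !size_map su; lia.
have uN : uniq N.
  rewrite map_inj_uniq ?take_uniq ?decr_pos_uniq // => x y /addrI/addrI/oppr_inj //.
apply: leq_card_fset.
  rewrite !cat_uniq fset_uniq uN map_inj_uniq ?uN; last exact: oppr_inj.
  rewrite andbT /= andbC; apply/andP; split.
    by apply/hasPn => _ /mapP[z /Ngt zt ->]; apply/negP => /Ngt; lia.
  apply/hasPn => z; rewrite mem_cat => zN; apply/negP => /(ssum0_bound ds) le.
  by move: zN => /orP[/Ngt|/mapP[y /Ngt yt zE]]; lia.
move=> x; rewrite !mem_cat => /or3P[|/Nmem//|/mapP[y /Nmem ys ->]]; last by rewrite ssum_oppr.
by move=> xs; rewrite ssum_swap ssum_skip.
Qed.

(** Removing [b] would only give [12 + 6] sums. The ten words are listed by strictly decreasing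
    value, from [b + 6 a] through [b + 3 a > 7 a] down to [a]. *)
Lemma card_ssum_3_124 (a b : int) : 0 < a -> 4 * a < b ->
  (19 <= #|` ssum 3 [:: 0; b; 4 * a; 2 * a; a]%R|)%N.
Proof.
move=> a0 ab; apply: leq_trans (@card_ssum_words 3 _ [:: [:: 0; 1; 1; 1; 0];
  [:: 0; 1; 1; 0; 1]; [:: 1; 1; 1; 0; 0]; [:: 0; 1; 0; 1; 1]; [:: 0; 0; 1; 1; 1];
  [:: 1; 0; 1; 1; 0]; [:: 1; 0; 1; 0; 1]; [:: 1; 0; 0; 1; 1]; [:: 1; 0; 1; -1; 0];
  [:: 1; 0; 0; 1; -1]] _ _) => //.
apply/andP; split.
  apply: (@sorted_uniq _ >%R); [by move=> x y z yx xz; apply: lt_trans xz yx|exact: ltxx|].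
  by rewrite /= !ternaryE; lia.
by rewrite /= !ternaryE; lia.
Qed.

(** With [k = m + 1], [2 h k - h (h + 1)] equals [2 h m - h (h - 1)]; the subtracted term is moved
    across to stay in the naturals. The induction removes maxima until [h] equals the size or three
    elements remain. *)
Lemma card_ssum_ge h s : decr_pos s -> (3 <= h <= size s)%N -> (4 <= size s)%N ->
  (2 * h * size s + 1 <= #|` ssum h (0%R :: s)| + h * h.-1)%N.
Proof.
elim: s => // b s IH db /andP[h3]; rewrite leq_eqVlt => /orP[/eqP-> s4|hs s4].
  have := card_full_or_near db s4; rewrite /full_or_near.
  by rewrite [size (_ :: _)]/=; set c := #|` _|; nia.
have {}hs : (h <= size s)%N by [].
have := db; rewrite decr_pos_cons => /and3P[b0 sb ds].
have := card_step_top db hs; have [s4'|s3] := leqP 4 (size s).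
  have := IH ds _ s4'; rewrite h3 hs => /(_ isT).
  by rewrite [size (_ :: _)]/=; set c := #|` _|; set c' := #|` _|; nia.
have hE : h = 3%N by move: s4 s3 hs h3 => /=; lia.
rewrite hE; case: s => [|c [|b' [|a [|]]]] // in db b0 sb ds IH hs s4 s3 *.
move: (ds) sb; rewrite !decr_pos_cons /= !andbT => /and5P[c0 /andP[bc ac] b'0 ab a0].
(* The goal is [2 * 3 * 4 + 1 = 19 + 6], and 19 is [13 + 6] unless the triple is exceptional. *)
case/and3P => cb _ _ le; rewrite -[(_ + 1)%N]/(19 + 6)%N leq_add2r.
case: (full_or_near3 a0 ab bc) => [le2|[bE cE _]].
  by apply: leq_trans le; rewrite -[19%N]/(13 + 6)%N leq_add2r.
by rewrite bE cE; apply: card_ssum_3_124 => //; rewrite -cE.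
Qed.

(** * Back to finite sets *)

(** The coefficients form a function on all integers, so that one function serves both a finite set
    and any list enumerating it. *)
Definition signed_rep (h : nat) (s : seq int) (x : int) (c : int -> int) :=
  [/\ forall a, c a \in signs, \sum_(a <- s) `|c a| = h%:Z & x = \sum_(a <- s) c a * a].

Lemma in_signs e : (e \in signs) = [|| e == -1, e == 0 | e == 1].
Proof. by rewrite !inE orbA. Qed.

Lemma restricted_signed_sumsetP h (A : {fset int}) x :
  reflect (exists c, signed_rep h A x c) (x \in restricted_signed_sumset h A).
Proof.
apply: (iffP (imfsetP _ _ _ _)) => [[lam /= /eqP wl ->]|[c [cs wc ->]]].
  (* Outside [A] the coefficient defaults to [0], which is in [signs]. *)
  exists (fun a => if insub a is Some u then fsval (lam u) else 0); split.
  - by move=> a; case: insubP => [u _ _|_]; [apply: fsvalP | rewrite in_signs].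
  - by rewrite -wl big_seq_fsetE; apply: eq_bigr => u _ /=; rewrite valK.
  - by rewrite big_seq_fsetE; apply: eq_bigr => u _ /=; rewrite valK.
exists [ffun u : A => [` cs (val u)] : signs].
  rewrite inE; apply/eqP; rewrite -wc big_seq_fsetE.
  by apply: eq_bigr => u _; rewrite ffunE.
by rewrite big_seq_fsetE; apply: eq_bigr => u _; rewrite ffunE.
Qed.

Lemma ssumP h s x : uniq s -> reflect (exists c, signed_rep h s x c) (x \in ssum h s).
Proof.
move=> us; apply: (iffP idP).
  elim: s h x us => [|a s IH] h x /=.
    rewrite ssum_nil => _ /andP[/eqP-> /eqP->]; exists (fun=> 0).
    by split=> [a||]; rewrite ?big_nil // in_signs.
  case/andP=> na us.
  (* As [a] is not in [s], its coefficient can be set to [e] without disturbing the others. *)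
  have ext e k y : e \in signs -> y \in ssum k s -> k%:Z + `|e| = h%:Z -> x = y + e * a ->
      exists c, signed_rep h (a :: s) x c.
    move=> es /(IH _ _ us)[c [cs wc yE]] hk xE; exists (fun z => if z == a then e else c z).
    have eqF (F : int -> int -> int) :
        \sum_(j <- s) F (if j == a then e else c j) j = \sum_(j <- s) F (c j) j.
      apply: eq_big_seq => z zs; case: eqP => // za; by rewrite -za zs in na.
    split=> [z||]; first by case: eqP.
      by rewrite big_cons eqxx (eqF (fun u _ => `|u|)) wc addrC.
    by rewrite big_cons eqxx (eqF (fun u z => u * z)) -yE addrC.
  case: h ext => [|h] ext.
    rewrite ssum0_cons => xs; apply: (ext 0 0%N x) => //; first by rewrite in_signs.
    by rewrite mul0r addr0.
  rewrite ssumS_cons => /or3P[xs|xs|xs].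
  - apply: (ext 0 h.+1 x) => //; first by rewrite in_signs.
      by rewrite normr0 addr0.
    by rewrite mul0r addr0.
  - apply: (ext 1 h _ _ xs); rewrite ?in_signs ?mul1r ?subrK //.
    by rewrite normr1; lia.
  - apply: (ext (-1) h _ _ xs); rewrite ?in_signs ?mulN1r ?addrK //.
    by rewrite normrN1; lia.
case=> c [cs wc ->]; have := @ssum_ternary [seq c a | a <- s] s.
have <- : \sum_(a <- s) c a * a = ternary_sum [seq c a | a <- s] s.
  by elim: (s) => [|a t IH]; rewrite ?big_nil ?ternary_sum_nil // big_cons ternary_sum_cons IH.
have <- : h = count (predC1 0) [seq c a | a <- s].
  apply/eqP; rewrite -eqz_nat -wc; apply/eqP.
  elim: (s) => [|a t IH]; first by rewrite big_nil.
  by rewrite big_cons IH /=; have := cs a; rewrite in_signs => /or3P[] /eqP->.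
apply; first by rewrite size_map.
by move=> _ /mapP[a _ ->]; have := cs a; rewrite in_signs !inE.
Qed.

Lemma restricted_signed_sumsetE h (A : {fset int}) s : uniq s -> s =i A ->
  restricted_signed_sumset h A = ssum h s.
Proof.
move=> us sA; have p : perm_eq s A by apply: uniq_perm.
apply/fsetP => x; apply/restricted_signed_sumsetP/(ssumP _ _ us) => -[c [cs wc xE]];
  exists c; split=> //; rewrite ?wc ?xE; by [rewrite -(perm_big _ p)|rewrite (perm_big _ p)].
Qed.

(** No two nonzero elements of [A] are opposite, so their absolute values are distinct and sorting
    makes them strictly decreasing. *)
Lemma antisymmetric_abs_decr (A : {fset int}) : A `&` oppset A = [fset 0] ->
  exists s, [/\ uniq (0 :: s), 0 :: s =i A & decr_pos [seq `|a| | a <- s]].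
Proof.
move=> /fsetP HA.
have opp a : (a \in A) && (- a \in A) = (a == 0).
  have := HA a; rewrite !inE => <-; congr (_ && _).
  by apply/idP/imfsetP => [na|[z zA ->]]; [exists (- a); rewrite ?opprK | rewrite opprK].
have A0 : 0 \in A by have := opp 0; rewrite eqxx => /andP[].
pose s := sort (relpre (fun a : int => `|a|) >=%R) (enum_fset (A `\ 0)).
have sE a : (a \in s) = (a != 0) && (a \in A) by rewrite mem_sort !inE.
have us : uniq s by rewrite sort_uniq fset_uniq.
exists s; split.
- by rewrite cons_uniq us sE eqxx.
- by move=> a; rewrite inE sE; have [->|] := eqVneq a 0.
have ua : uniq [seq `|a| | a <- s].
  rewrite map_inj_in_uniq // => a b; rewrite !sE => /andP[a0 aA] /andP[b0 bA] ab.
  have [//|ba] : a = b \/ a = - b by lia.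
  by have := opp b; rewrite bA -ba aA (negPf b0).
have sa : sorted >=%R [seq `|a| | a <- s].
  by rewrite sorted_map; apply: sort_sorted => a b /=; exact: le_total.
apply/andP; split; last first.
  by apply/allP => _ /mapP[a + ->]; rewrite sE normr_gt0 => /andP[].
elim: [seq _ | a <- s] sa ua => //= a t IH.
rewrite !path_sortedE; try by move=> x y z yx xz; first [apply: lt_trans xz yx | apply: le_trans xz yx].
move=> /andP[/allP at_ st] /andP[na ut]; rewrite (IH st ut) andbT; apply/allP => z zt.
rewrite /= lt_neqAle; have /= -> := at_ z zt; rewrite andbT.
by apply: contra na => /eqP <-.
Qed.

Lemma restricted_signed_sumset_ge h (A : {fset int}) : A `&` oppset A = [fset 0] ->
    (3 <= h <= #|` A| - 1)%N -> (5 <= #|` A|)%N ->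
  (2 * h * #|` A| + 1 <= #|` restricted_signed_sumset h A| + h * h.+1)%N.
Proof.
move=> /antisymmetric_abs_decr[s [us sA ds]].
have -> : #|` A| = (size s).+1.
  by rewrite -[RHS]/(size (0%R :: s)); apply/perm_size; rewrite perm_sym uniq_perm.
rewrite (restricted_signed_sumsetE h us sA) -ssum_norm map_cons normr0 => hs s4.
have := card_ssum_ge ds; rewrite size_map => /(_ h).
rewrite subn1 in hs; move=> /(_ hs s4); case: h hs => // h _.
move=> le; rewrite mulnS (_ : h.+1 * h.+2 = 2 * h.+1 + h.+1 * h)%N; last by nia.
by rewrite -addnA [leqRHS]addnCA leq_add2l.
Qed.

(** * Equality for [{0, ..., k - 1}] *)

Lemma top_sum_nat n h : (h <= n)%N ->
  2 * top_sum h [seq i%:Z | i <- rev (iota 1 n)] = h%:Z * (2 * n%:Z - h%:Z + 1).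
Proof.
elim: n h => [|n IH] [|h] // hn.
- by rewrite /top_sum big_nil mul0r mulr0.
- by rewrite /top_sum take0 big_nil mul0r mulr0.
rewrite -[n.+1]addn1 iotaD rev_cat map_cat /= /top_sum /= big_cons mulrDr IH //.
by rewrite -[(1 + n)%N]/(n.+1); lia.
Qed.

Lemma decr_pos_nat n : decr_pos [seq i%:Z | i <- rev (iota 1 n)].
Proof.
elim: n => // n IH; rewrite -[n.+1]addn1 iotaD rev_cat map_cat decr_pos_cons /= IH andbT.
by apply/allP => _ /mapP[i + ->]; rewrite mem_rev mem_iota; lia.
Qed.

Lemma card_ball_leq (X : {fset int}) (m : nat) :
  (forall x, x \in X -> `|x| <= m%:Z) -> (#|` X| <= 2 * m + 1)%N.
Proof.
move=> XM; have := @uniq_leq_size _ (enum_fset X) [seq i%:Z - m%:Z | i <- iota 0 (2 * m + 1)].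
rewrite size_map size_iota; apply; first exact: fset_uniq.
move=> x /XM xm; apply/mapP; exists `|(x + m%:Z)%R|%N; last by lia.
by rewrite mem_iota; lia.
Qed.

(** The positive part is listed in decreasing order to fit the form [0 :: s] with [decr_pos s]. *)
Definition initial_segment (n : nat) : {fset int} :=
  [fset x in 0 :: [seq i%:Z | i <- rev (iota 1 n)]].

Lemma initial_segment_uniq n : uniq (0 :: [seq i%:Z | i <- rev (iota 1 n)]).
Proof.
rewrite cons_uniq (decr_pos_uniq (decr_pos_nat n)) andbT.
by apply/negP => /(decr_pos_gt0 (decr_pos_nat n)); rewrite ltxx.
Qed.

Lemma card_initial_segment n : #|` initial_segment n| = n.+1.
Proof.
rewrite card_fseq undup_id ?initial_segment_uniq //.
by rewrite /= size_map size_rev size_iota.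
Qed.

Lemma initial_segment_opp n :
  initial_segment n `&` oppset (initial_segment n) = [fset 0].
Proof.
have ge0 x : x \in initial_segment n -> 0 <= x.
  by rewrite !inE => /orP[/eqP->//|/(decr_pos_gt0 (decr_pos_nat n))/ltW].
have in0 : 0 \in initial_segment n by rewrite !inE eqxx.
apply/fsetP => x; rewrite in_fsetI in_fset1; apply/andP/eqP => [[/ge0 x0 /imfsetP[y /ge0 y0 xE]]|->].
  by move: xE => /= xE; lia.
by split=> //; apply/imfsetP; exists 0; rewrite ?oppr0.
Qed.

(** The sums are integers of absolute value at most [top_sum h s], so there are at most
    [2 * top_sum h s + 1] of them. *)
Lemma card_initial_segment_leq h n : (h <= n)%N ->
  #|` restricted_signed_sumset h (initial_segment n)|%:Z <= h%:Z * (2 * n%:Z - h%:Z + 1) + 1.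
Proof.
move=> hn; rewrite -(top_sum_nat hn); set s := [seq _ | _ <- _].
have sA : 0 :: s =i initial_segment n by move=> x; rewrite !inE.
have ds : decr_pos s := decr_pos_nat n.
have t0 : 0 <= top_sum h s.
  by rewrite /top_sum big_seq; apply: sumr_ge0 => x /mem_take/(decr_pos_gt0 ds)/ltW.
rewrite (restricted_signed_sumsetE h (initial_segment_uniq n) sA).
have := @card_ball_leq (ssum h (0 :: s)) `|top_sum h s|%N; rewrite gez0_abs // => H.
have {}H := H (fun x => @ssum0_bound h s x ds).
by move: (top_sum h s) t0 H => t; set c := #|` _|; lia.
Qed.

Unset Implicit Arguments.

Theorem theorem1p3 (h k : nat) (h_ge3 : (3 <= h)%N) (h_le : (h <= k - 1)%N)
    (k_ge5 : (5 <= k)%N) :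
  (forall A : {fset int},
      #|` A| = k -> A `&` oppset A = [fset 0] ->
      2 * h%:Z * k%:Z - h%:Z * (h%:Z + 1) + 1
        <= #|` restricted_signed_sumset h A|%:Z) /\
  (exists A : {fset int},
      [/\ #|` A| = k, A `&` oppset A = [fset 0] &
          #|` restricted_signed_sumset h A|%:Z
            = 2 * h%:Z * k%:Z - h%:Z * (h%:Z + 1) + 1]).
Proof.
have lower (A : {fset int}) : #|` A| = k -> A `&` oppset A = [fset 0] ->
    2 * h%:Z * k%:Z - h%:Z * (h%:Z + 1) + 1 <= #|` restricted_signed_sumset h A|%:Z.
  move=> cA oA; have := @restricted_signed_sumset_ge h A oA; rewrite cA h_ge3 h_le.
  by move=> /(_ isT k_ge5); set c := #|` _|; lia.
split=> //; exists (initial_segment k.-1).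
have cA : #|` initial_segment k.-1| = k by rewrite card_initial_segment; lia.
split=> //; first exact: initial_segment_opp.
apply/eqP; rewrite eq_le lower ?initial_segment_opp // andbT.
have hk : (h <= k.-1)%N by lia.
(* With [n = k - 1], [h (2 n - h + 1) + 1] is exactly the lower bound. *)
apply: le_trans (card_initial_segment_leq hk) _.
by rewrite -[in leRHS](ltn_predK k_ge5); lia.
Qed.
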